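(* Let $H$ be an infinite-dimensional separable complex Hilbert space, let $A\in C([0,1], L(H))$ and let $d \in C([0,1])$ be such that $d(t)\in \operatorname{Int} W_e(A(t))$ for all $t\in[0,1]$; let $\theta=\min\{\operatorname{dist} (d(t),\partial W_e(A(t))): 0\le t\le 1\}$, let $\varepsilon\in (0,\theta)$, and let $v \in C([0,1], S_H)$ satisfy $|\langle A(t)v(t),v(t)\rangle-d(t)|\le \varepsilon$ for all $t\in[0,1]$. If $M\subset H$ is a closed infinite-dimensional subspace such that $W_e(P_MA(t){\upharpoonright}_M)=W_e(A(t))$ for all $t \in [0,1]$, then there exists $u \in C([0,1], H)$ such that for all $t \in [0,1]$: (i) $\langle A(t)u(t),u(t)\rangle=d(t)$ and $\|u(t)\|=1$; (ii) $\|u(t)-v(t)\|\le 12\sqrt{\varepsilon/\theta}$; (iii) $u(t)\in \operatorname{span}\{v(t)\}\vee M$.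
   Context: $S_H=\{x\in H:\|x\|=1\}$ is the unit sphere. $\vee$ denotes the closed linear span of the union of subspaces. $P_M$ is the orthogonal projection onto $M$. For $T\in L(K)$ the essential numerical range $W_e(T)$ is the set of all $\lambda\in\mathbb C$ for which there is an orthonormal sequence $(u_n)$ in $K$ with $\langle Tu_n,u_n\rangle\to\lambda$; $\operatorname{Int}$, $\partial$ are interior and boundary in $\mathbb C$. *)

(* Defs.v *)
From HB Require Import structures.
From mathcomp Require Import all_boot all_order all_algebra.
From mathcomp Require Import complex.
From mathcomp Require Import classical_sets reals.
Set Implicit Arguments. Unset Strict Implicit. Unset Printing Implicit Defensive.
Import Order.TTheory GRing.Theory Num.Theory.
Local Open Scope ring_scope.
Local Open Scope classical_set_scope.

Section Hilbert.
Variable R : realType.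
Local Notation C := R[i].

Definition cabs (z : C) : R := complex.Re `|z|.

Variable H : lmodType C.
Variable ip : H -> H -> C.

Definition inner_product : Prop :=
  [/\ forall (a : C) (x y z : H), ip (a *: x + y) z = a * ip x z + ip y z,
      forall x y : H, ip y x = conjc (ip x y),
      forall x : H, 0 <= ip x x &
      forall x : H, ip x x = 0 -> x = 0].

Definition hnorm (x : H) : R := Num.sqrt (complex.Re (ip x x)).

Definition cvgH (u : nat -> H) (x : H) : Prop :=
  forall e : R, 0 < e -> exists N : nat, forall n, (N <= n)%N -> hnorm (u n - x) < e.

Definition cvgC (z : nat -> C) (l : C) : Prop :=
  forall e : R, 0 < e -> exists N : nat, forall n, (N <= n)%N -> cabs (z n - l) < e.

Definition cauchyH (u : nat -> H) : Prop :=
  forall e : R, 0 < e -> exists N : nat, forall n m, (N <= n)%N -> (N <= m)%N ->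
    hnorm (u n - u m) < e.

Definition complete_space : Prop := forall u, cauchyH u -> exists x, cvgH u x.

Definition separable : Prop :=
  exists f : nat -> H, forall (x : H) (e : R), 0 < e -> exists n, hnorm (x - f n) < e.

Definition lincomb (S : set H) (x : H) : Prop :=
  exists (n : nat) (c : 'I_n -> C) (w : 'I_n -> H),
    (forall i, S (w i)) /\ x = \sum_(i < n) c i *: w i.

Definition finite_dim (S : set H) : Prop :=
  exists (n : nat) (w : 'I_n -> H), (forall i, S (w i)) /\
    forall x, S x -> exists c : 'I_n -> C, x = \sum_(i < n) c i *: w i.

Definition is_subspace (M : set H) : Prop :=
  M 0 /\ forall (a : C) (x y : H), M x -> M y -> M (a *: x + y).

Definition closedH (M : set H) : Prop :=
  forall (u : nat -> H) (x : H), (forall n, M (u n)) -> cvgH u x -> M x.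

Definition clspan (S : set H) (x : H) : Prop :=
  forall e : R, 0 < e -> exists y, lincomb S y /\ hnorm (x - y) < e.

Definition orth_proj (M : set H) (P : H -> H) : Prop :=
  forall x : H, M (P x) /\ forall m, M m -> ip (x - P x) m = 0.

Definition bounded_op (T : H -> H) : Prop :=
  (forall (a : C) (x y : H), T (a *: x + y) = a *: T x + T y) /\
  exists K : R, forall x, hnorm (T x) <= K * hnorm x.

Definition orthonormal (u : nat -> H) : Prop :=
  forall n m : nat, ip (u n) (u m) = (n == m)%:R.

Definition We (K : set H) (T : H -> H) : set C :=
  [set l | exists u : nat -> H, (forall n, K (u n)) /\ orthonormal u /\
           cvgC (fun n => ip (T (u n)) (u n)) l].

Definition I01 (t : R) : Prop := 0 <= t <= 1.

Definition contH (f : R -> H) : Prop :=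
  forall t, I01 t -> forall e : R, 0 < e -> exists2 del : R, 0 < del &
    forall s, I01 s -> `|s - t| < del -> hnorm (f s - f t) < e.

Definition contOp (A : R -> H -> H) : Prop :=
  forall t, I01 t -> forall e : R, 0 < e -> exists2 del : R, 0 < del &
    forall s, I01 s -> `|s - t| < del -> forall x, hnorm (A s x - A t x) <= e * hnorm x.

End Hilbert.

Section Plane.
Variable R : realType.
Local Notation C := R[i].

Definition contC (f : R -> C) : Prop :=
  forall t, I01 t -> forall e : R, 0 < e -> exists2 del : R, 0 < del &
    forall s, I01 s -> `|s - t| < del -> cabs (f s - f t) < e.

Definition interiorC (S : set C) : set C :=
  [set l | exists2 r : R, 0 < r & forall z, cabs (z - l) < r -> S z].

Definition boundaryC (S : set C) : set C :=
  [set l | forall r : R, 0 < r ->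
     (exists z, cabs (z - l) < r /\ S z) /\ (exists z, cabs (z - l) < r /\ ~ S z)].

Definition distC (l : C) (S : set C) : R := inf [set cabs (l - z) | z in S].
End Plane.

(* Main.v *)
(** Given v with <A v, v> within eps of d, put lam = d + (d - <A v, v>) theta / (4 eps).
    It stays in the disc of radius theta around d, which lies in the essential numerical
    range of the compression of A to M. Each lam(t) is therefore nearly attained at unit
    vectors of M that are almost orthogonal to any prescribed finite set of vectors, and
    such vectors can be glued into a continuous path w in M. With c^2 + s^2 = 1 and
    s^2 / c^2 = 4 eps / theta, the normalised vector u = (c v + s w) / |c v + s w| has
    <A u, u> as close to d as desired and lies within 6 sqrt(eps / theta) of v. Iterating
    with eps / 16^k gives corrections summing to at most 8 sqrt(eps / theta), and the
    limit is exact. *)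
Require Import Defs.
From HB Require Import structures.
From mathcomp Require Import all_boot all_order all_algebra.
From mathcomp Require Import complex.
From mathcomp Require Import boolp classical_sets reals.
From mathcomp Require Import ring lra.
Set Implicit Arguments.
Unset Strict Implicit.
Unset Printing Implicit Defensive.
Import Order.TTheory GRing.Theory Num.Theory.
Local Open Scope ring_scope.
Local Open Scope classical_set_scope.

(** * Real-valued modulus on the complex numbers *)

Section ComplexModulus.
Local Open Scope complex_scope.
Variable R : realType.
Implicit Types z w : R[i].

Lemma cabsE z : (cabs z)%:C = `|z|.
Proof. by rewrite /cabs normc_def. Qed.

Lemma cabs_ge0 z : 0 <= cabs z.
Proof. by rewrite -ler0c cabsE. Qed.

Lemma cabsD z w : cabs (z + w) <= cabs z + cabs w.
Proof. by rewrite -lecR rmorphD /= !cabsE ler_normD. Qed.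

Lemma cabsM z w : cabs (z * w) = cabs z * cabs w.
Proof. by apply: complexI; rewrite rmorphM /= !cabsE normrM. Qed.

Lemma cabsN z : cabs (- z) = cabs z.
Proof. by apply: complexI; rewrite !cabsE normrN. Qed.

Lemma cabsBC z w : cabs (z - w) = cabs (w - z).
Proof. by rewrite -cabsN opprB. Qed.

Lemma cabsB z w : cabs (z - w) <= cabs z + cabs w.
Proof. by rewrite -(cabsN w) cabsD. Qed.

Lemma cabs0 : cabs (0 : R[i]) = 0.
Proof. by apply: complexI; rewrite cabsE normr0. Qed.

Lemma cabs0_eq0 z : cabs z = 0 -> z = 0.
Proof. by move=> z0; apply/normr0_eq0; rewrite -cabsE z0. Qed.

Lemma cabs_real (r : R) : cabs r%:C = `|r|.
Proof. by rewrite /cabs normc_def /= expr0n /= addr0 sqrtr_sqr. Qed.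

Lemma cabs_conjc z : cabs (conjc z) = cabs z.
Proof. by case: z => a b; rewrite /cabs !normc_def /= sqrrN. Qed.

Lemma cabs_sqr z : (cabs z ^+ 2)%:C = z * conjc z.
Proof.
rewrite rmorphXn /= cabsE -add_Re2_Im2; case: z => a b /=.
by apply/eqP; rewrite eq_complex /=; apply/andP; split; apply/eqP; ring.
Qed.

Lemma Re_le_cabs z : `|complex.Re z| <= cabs z.
Proof.
rewrite /cabs normc_def /= -sqrtr_sqr ler_sqrt ?lerDl ?sqr_ge0 //.
by rewrite addr_ge0 ?sqr_ge0.
Qed.

Lemma cabs_tri (a b c : R[i]) : cabs (a - c) <= cabs (a - b) + cabs (b - c).
Proof. by rewrite -(subrK b a) -addrA; apply: le_trans (cabsD _ _) _; rewrite subrK. Qed.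

End ComplexModulus.

(** * Algebra of the inner product, Cauchy-Schwarz and the norm *)

Section InnerProduct.
Local Open Scope complex_scope.
Variables (R : realType) (H : lmodType R[i]) (ip : H -> H -> R[i]).
Hypothesis Hip : inner_product ip.
Local Notation nm := (hnorm ip).
Implicit Types (x y z : H) (a b : R[i]).

Lemma ip_conj x y : ip y x = conjc (ip x y).
Proof. by case: Hip. Qed.

Lemma ip_lin a x y z : ip (a *: x + y) z = a * ip x z + ip y z.
Proof. by case: Hip. Qed.

Lemma ip0l z : ip 0 z = 0.
Proof.
have := ip_lin 1 0 0 z; rewrite scaler0 addr0 mul1r => /eqP.
by rewrite -subr_eq0 opprD addrA subrr add0r oppr_eq0 => /eqP.
Qed.

Lemma ipDl x y z : ip (x + y) z = ip x z + ip y z.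
Proof. by rewrite -{1}(scale1r x) ip_lin mul1r. Qed.

Lemma ipZl a x z : ip (a *: x) z = a * ip x z.
Proof. by rewrite -{1}(addr0 (a *: x)) ip_lin ip0l addr0. Qed.

Lemma ipNl x z : ip (- x) z = - ip x z.
Proof. by rewrite -scaleN1r ipZl mulN1r. Qed.

Lemma ipBl x y z : ip (x - y) z = ip x z - ip y z.
Proof. by rewrite ipDl ipNl. Qed.

Lemma ipDr x y z : ip z (x + y) = ip z x + ip z y.
Proof. by rewrite ip_conj ipDl rmorphD /= -!ip_conj. Qed.

Lemma ipZr a x z : ip z (a *: x) = conjc a * ip z x.
Proof. by rewrite ip_conj ipZl rmorphM /= -!ip_conj. Qed.

Lemma ipNr x z : ip z (- x) = - ip z x.
Proof. by rewrite ip_conj ipNl rmorphN /= -!ip_conj. Qed.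

Lemma ipBr x y z : ip z (x - y) = ip z x - ip z y.
Proof. by rewrite ipDr ipNr. Qed.

Lemma ip_self x : ip x x = (nm x ^+ 2)%:C.
Proof.
case: Hip => _ _ ge0 _; have := ge0 x; rewrite /hnorm.
by case: (ip x x) => a b; rewrite lecE /= => /andP[/eqP -> ?]; rewrite sqr_sqrtr.
Qed.

Lemma nm_ge0 x : 0 <= nm x.
Proof. exact: sqrtr_ge0. Qed.

Lemma nm_eq0 x : nm x = 0 -> x = 0.
Proof. by case: Hip => _ _ _ h h0; apply: h; rewrite ip_self h0 expr0n. Qed.

Lemma nmZ a x : nm (a *: x) = cabs a * nm x.
Proof.
apply/eqP; rewrite -(eqrXn2 (n := 2)) ?mulr_ge0 ?cabs_ge0 ?nm_ge0 //.
apply/eqP/complexI; rewrite exprMn -ip_self ipZl ipZr ip_self mulrA -cabs_sqr.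
by rewrite -[LHS]rmorphM.
Qed.

Lemma nmN x : nm (- x) = nm x.
Proof. by rewrite /hnorm ipNl ipNr opprK. Qed.

Lemma nmBC x y : nm (x - y) = nm (y - x).
Proof. by rewrite -nmN opprB. Qed.

Lemma nm0 : nm 0 = 0.
Proof. by rewrite /hnorm ip0l sqrtr0. Qed.

Lemma nmZr (r : R) x : nm (r%:C *: x) = `|r| * nm x.
Proof. by rewrite nmZ cabs_real. Qed.

(** With k = |y|^2, the square norm of k x - <x, y> y equals |y|^2 (|y|^2 |x|^2 - |<x, y>|^2).
    Scaling x by k avoids a division. *)
Lemma cauchy_schwarz x y : cabs (ip x y) <= nm x * nm y.
Proof.
have [y0|yn0] := eqVneq (nm y) 0.
  by rewrite (nm_eq0 y0) ip_conj ip0l conjc0 cabs0 mulr_ge0 ?nm_ge0.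
have ypos : 0 < nm y by rewrite lt_def yn0 nm_ge0.
pose k := (nm y ^+ 2)%:C.
have : 0 <= complex.Re (ip (k *: x - ip x y *: y) (k *: x - ip x y *: y)).
  by rewrite ip_self /= sqr_ge0.
have -> : ip (k *: x - ip x y *: y) (k *: x - ip x y *: y) =
    (nm y ^+ 2 * (nm y ^+ 2 * nm x ^+ 2 - cabs (ip x y) ^+ 2))%:C.
  rewrite [RHS]rmorphM rmorphB [X in _ * (X - _)]rmorphM [X in _ = _ * (_ - X)]cabs_sqr.
  rewrite ipBl !ipBr !ipZl !ipZr conjc_real (ip_self x) (ip_self y) (ip_conj x y) -/k.
  ring.
rewrite /= pmulr_rge0 ?exprn_gt0 // subr_ge0 -exprMn mulrC.
by rewrite ler_pXn2r // nnegrE ?cabs_ge0 ?mulr_ge0 ?nm_ge0.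
Qed.

Lemma nmD_sqr x y :
  nm (x + y) ^+ 2 = nm x ^+ 2 + 2 * complex.Re (ip x y) + nm y ^+ 2.
Proof.
have nmE u : nm u ^+ 2 = complex.Re (ip u u) by rewrite ip_self.
rewrite !nmE ipDl !ipDr (ip_conj x y).
by case: (ip x x) (ip x y) (ip y y) => a b [c e] [f g] /=; ring.
Qed.

Lemma nmD x y : nm (x + y) <= nm x + nm y.
Proof.
rewrite -(ler_pXn2r (n := 2)) ?nnegrE ?addr_ge0 ?nm_ge0 // nmD_sqr.
have h1 := le_trans (Re_le_cabs _) (cauchy_schwarz x y).
have h2 := ler_norm (complex.Re (ip x y)).
by nra.
Qed.

Lemma nm_tri x y z : nm (x - z) <= nm (x - y) + nm (y - z).
Proof. by rewrite -{1}(subrK y x) -addrA nmD. Qed.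

Lemma nm_dist x y : `|nm x - nm y| <= nm (x - y).
Proof.
have h1 := nmD (x - y) y; have h2 := nmD (y - x) x.
by rewrite subrK in h1; rewrite subrK nmBC in h2; rewrite ler_norml; apply/andP; split; lra.
Qed.

Lemma nm_le_lim x y (c : R) :
  (forall e, 0 < e -> exists2 z, nm (x - z) < e & nm (z - y) <= c) -> nm (x - y) <= c.
Proof.
move=> h; rewrite leNgt; apply/negP => lt.
have [z h1 h2] := h (nm (x - y) - c) ltac:(lra).
have := nm_tri x z y; lra.
Qed.

End InnerProduct.

(** * Induction along [0,1] and continuity of scalar functions *)

Section UnitInterval.
Variable R : realType.

(** The conclusions of [contH], [contC] and [contOp] at t unfold to this form, so their estimates
    can be intersected and weakened by the two lemmas that follow. *)
Definition nearI (t : R) (Q : R -> Prop) : Prop :=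
  exists2 del : R, 0 < del & forall s, I01 s -> `|s - t| < del -> Q s.

Lemma nearI_and t Q Q' : nearI t Q -> nearI t Q' -> nearI t (fun s => Q s /\ Q' s).
Proof.
move=> [a a0 ha] [b b0 hb]; exists (Num.min a b); first by rewrite lt_min a0 b0.
by move=> s Is; rewrite lt_min => /andP[/(ha s Is) ? /(hb s Is)].
Qed.

Lemma nearI_sub t (Q Q' : R -> Prop) :
  (forall s, I01 s -> Q s -> Q' s) -> nearI t Q -> nearI t Q'.
Proof. by move=> h [a a0 ha]; exists a => // s Is /(ha s Is); apply: h. Qed.

(** Around the supremum of the parameters where Q holds, the step carries Q from a parameter at or
    just below it to one beyond it, or to 1. This stands in for a compactness argument when local
    constructions are glued from left to right. *)
Lemma real_induction (Q : R -> Prop) : Q 0 ->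
  (forall t, I01 t -> exists2 del, 0 < del &
    forall x y, I01 x -> I01 y -> `|x - t| < del -> `|y - t| < del -> x < y ->
      Q x -> Q y) -> Q 1.
Proof.
move=> Q0 step; pose E := [set x : R | I01 x /\ Q x].
have E0 : E 0 by split=> //; apply/andP; split; lra.
have hsE : has_sup E.
  by split; [exists 0 | exists 1 => x [/andP[_ ?] _]].
have I_s : I01 (sup E).
  apply/andP; split; first exact: (sup_upper_bound hsE).
  by apply: ge_sup; [exists 0 | move=> x [/andP[_ ?] _]].
have [del del0 hdel] := step _ I_s.
have [x [Ix Qx] ltx] := sup_adherent del0 hsE.
have xs : x <= sup E by apply: (sup_upper_bound hsE).
(* Truncation at 1 keeps y in [0,1]; y can fail to exceed the supremum only if y = 1. If y <= x,
   this forces x = 1 and Q x is already the goal. *)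
pose y := Num.min 1 (sup E + del / 2).
have [s0 s1] := andP I_s; have [x0 x1] := andP Ix.
have y1 : y <= 1 by rewrite ge_min lexx.
have ys : y <= sup E + del / 2 by rewrite ge_min lexx orbT.
have sy : sup E <= y by rewrite le_min s1 /=; lra.
have Iy : I01 y by apply/andP; split; lra.
have y_eq1 : y <= sup E -> y = 1.
  rewrite /y; have [h|/ltW h] := leP 1 (sup E + del / 2); first by [].
  rewrite gerDl => hd; exfalso; lra.
clearbody y; have [lt_xy|le_yx] := ltP x y.
  have Qy : Q y.
    apply: (hdel x y) => //; rewrite ltr_norml; apply/andP; split; lra.
  by rewrite -y_eq1 //; apply: (sup_upper_bound hsE).
suff -> : 1 = x by [].
by have := y_eq1 (le_trans le_yx xs); lra.
Qed.

(** Supplies the tolerance in the continuity proofs: K collects the constants of a linear estimate,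
    and m <= 1 absorbs products of two small terms. *)
Lemma small_factor (K e : R) : 0 <= K -> 0 < e -> exists2 m, 0 < m <= 1 & m * K < e.
Proof.
move=> K0 e0; exists (e / (K + 1 + e)); last first.
  by rewrite mulrAC ltr_pdivrMr; nra.
by apply/andP; split; [apply: divr_gt0; lra | rewrite ler_pdivrMr; lra].
Qed.

Definition contR (f : R -> R) : Prop :=
  forall t, I01 t -> forall e, 0 < e -> nearI t (fun s => `|f s - f t| < e).

Lemma contR_lip (K : R) (f : R -> R) :
  (forall s t, `|f s - f t| <= K * `|s - t|) -> contR f.
Proof.
move=> h t _ e e0; have K0 : 0 <= `|K| by [].
have [m /andP[m0 _] hm] := small_factor K0 e0.
exists m => // s _ hs; apply: le_lt_trans (h s t) _.
have := ler_norm K; have : 0 <= `|s - t| by []; nra.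
Qed.

(** For nonnegative a and b one has (a - b)^2 <= |a^2 - b^2|, so the tolerance e^2 for f
    suffices. *)
Lemma contR_sqrt (f : R -> R) :
  (forall t, 0 <= f t) -> contR f -> contR (fun t => Num.sqrt (f t)).
Proof.
move=> f0 hf t It e e0; have e2 : 0 < e ^+ 2 by rewrite exprn_gt0.
apply: nearI_sub (hf t It _ e2) => s Is; rewrite -{1}(sqr_sqrtr (f0 s)) -{1}(sqr_sqrtr (f0 t)).
move: (sqrtr_ge0 (f s)) (sqrtr_ge0 (f t)).
move: (Num.sqrt (f s)) (Num.sqrt (f t)) => a b a0 b0.
by rewrite !ltr_norml => /andP[h1 h2]; apply/andP; split; nra.
Qed.

Lemma contR_inv (f : R -> R) :
  (forall t, I01 t -> 1 / 2 <= f t) -> contR f -> contR (fun t => (f t)^-1).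
Proof.
(* Both inverses are at most 2, so their product costs a factor 4. *)
move=> f0 hf t It e e0; have e4 : 0 < e / 4 by lra.
apply: nearI_sub (hf t It _ e4) => s Is.
have hs := f0 s Is; have ht := f0 t It.
have -> : (f s)^-1 - (f t)^-1 = - ((f s)^-1 * (f t)^-1) * (f s - f t).
  by field; apply/andP; split; apply: lt0r_neq0; lra.
rewrite normrM normrN (ger0_norm (x := _ * _)); last first.
  by apply: mulr_ge0; rewrite invr_ge0; lra.
have bnd (x : R) : 1 / 2 <= x -> 0 < x^-1 <= 2.
  move=> hx; rewrite invr_gt0 -[X in _ <= X]invrK lef_pV2 ?posrE ?invr_gt0; lra.
have /andP[h1 h2] := bnd _ hs; have /andP[h3 h4] := bnd _ ht.
have h5 : (f s)^-1 * (f t)^-1 <= 4 by nra.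
have : 0 <= `|f s - f t| by [].
nra.
Qed.

(** The square roots of [ramp] and of its complement to 1 are the weights that rotate one vector
    into another over [x, y]. *)
Definition ramp (x y s : R) : R := Num.max 0 (Num.min 1 ((s - x) / (y - x))).

Lemma ramp_ge0 x y s : 0 <= ramp x y s.
Proof. by rewrite le_max lexx. Qed.

Lemma ramp_le1 x y s : ramp x y s <= 1.
Proof. by rewrite ge_max ler01 ge_min lexx. Qed.

Lemma ramp_left x y s : x < y -> s <= x -> ramp x y s = 0.
Proof.
move=> xy sx; apply: max_l; rewrite ge_min ler_pdivrMr ?subr_gt0 // mul0r; apply/orP; right; lra.
Qed.

Lemma ramp_right x y s : x < y -> y <= s -> ramp x y s = 1.
Proof.
move=> xy sx; rewrite /ramp min_l ?max_r // ler_pdivlMr ?subr_gt0 //; lra.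
Qed.

Lemma ramp_cont x y : x < y -> contR (ramp x y).
Proof.
move=> xy; apply: (contR_lip (K := (y - x)^-1)) => s t.
(* Clipping to [0,1] is 1-Lipschitz, so the ramp inherits the slope of its affine part. *)
pose c (a : R) := Num.max 0 (Num.min 1 a).
have cE a : [\/ a <= 0 /\ c a = 0, 0 <= a <= 1 /\ c a = a | 1 <= a /\ c a = 1].
  rewrite /c; have [h1|/ltW h1] := leP 1 a; first by apply: Or33; rewrite max_r.
  by have [h0|h0] := leP a 0; [apply: Or31 | apply: Or32; rewrite h1 ltW].
have clip a b : `|c a - c b| <= `|a - b|.
  have h1 := ler_norm (a - b); have h2 := ler_norm (b - a).
  rewrite distrC in h2; rewrite ler_norml; apply/andP.
  have [[? ->]|[/andP[? ?] ->]|[? ->]] := cE a;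
    have [[? ->]|[/andP[? ?] ->]|[? ->]] := cE b; split; lra.
apply: le_trans (clip _ _) _.
rewrite -mulrBl opprB addrA subrK normrM mulrC ger0_norm // invr_ge0; lra.
Qed.

Lemma contC_bounded (d : R -> R[i]) : contC d ->
  exists2 B : R, 0 <= B & forall t, I01 t -> cabs (d t) <= B.
Proof.
move=> dc.
pose Q x := exists2 B : R, 0 <= B & forall t, I01 t -> t <= x -> cabs (d t) <= B.
suff [B B0 hB] : Q 1 by exists B => // t It; apply: hB => //; case/andP: It.
apply: real_induction.
  exists (cabs (d 0)); first exact: cabs_ge0.
  move=> t /andP[t0 _] t1; suff -> : t = 0 by [].
  by apply/le_anti/andP.
move=> t It; have [del del0 hdel] := dc t It 1 ltr01.
exists del => // x y Ix Iy hx hy xy [B B0 hB].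
exists (B + cabs (d t) + 1); first by have := cabs_ge0 (d t); lra.
move=> s Is sy; have [sx|xs] := leP s x.
  by have := hB s Is sx; have := cabs_ge0 (d t); lra.
have hs : `|s - t| < del.
  move: hx hy; rewrite !ltr_norml => /andP[? ?] /andP[? ?]; apply/andP; split; lra.
have := hdel s Is hs; have := cabsD (d s - d t) (d t); rewrite subrK; lra.
Qed.

End UnitInterval.

(** * Continuity of vector-valued paths on [0,1] *)

Section HilbertContinuity.
Local Open Scope complex_scope.
Variables (R : realType) (H : lmodType R[i]) (ip : H -> H -> R[i]).
Hypothesis Hip : inner_product ip.
Local Notation nm := (hnorm ip).
Local Notation contH := (contH ip).
Implicit Types f g : R -> H.

Lemma contH_const x : contH (fun _ => x).
Proof. by move=> t _ e e0; exists 1 => // s _ _; rewrite subrr nm0. Qed.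

Lemma contHD f g : contH f -> contH g -> contH (fun t => f t + g t).
Proof.
move=> hf hg t It e e0; have e2 : 0 < e / 2 by lra.
apply: nearI_sub (nearI_and (hf t It _ e2) (hg t It _ e2)) => s Is [h1 h2].
rewrite opprD addrACA; have := nmD Hip (f s - f t) (g s - g t); lra.
Qed.

Lemma contHZ (a : R -> R) f : contR a -> contH f -> contH (fun t => (a t)%:C *: f t).
Proof.
move=> ha hf t It e e0.
have K0 : 0 <= `|a t| + nm (f t) + 1 by rewrite !addr_ge0 ?nm_ge0.
have [m /andP[m0 m1] hm] := small_factor K0 e0.
apply: nearI_sub (nearI_and (ha t It _ m0) (hf t It _ m0)) => s Is [h1 h2].
have -> : (a s)%:C *: f s - (a t)%:C *: f t =
    (a s)%:C *: (f s - f t) + (a s - a t)%:C *: f t.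
  by rewrite rmorphB /= scalerBr scalerBl addrA subrK.
apply: le_lt_trans (nmD Hip _ _) _; rewrite !(nmZr Hip).
have := ler_normD (a s - a t) (a t); rewrite subrK.
have := nm_ge0 ip (f t); have := nm_ge0 ip (f s - f t).
have : 0 <= `|a t| by []. have : 0 <= `|a s| by [].
nra.
Qed.

Lemma contH_nm f : contH f -> contR (fun t => nm (f t)).
Proof.
move=> hf t It e e0; apply: nearI_sub (hf t It e e0) => s Is.
exact: le_lt_trans (nm_dist Hip _ _).
Qed.

Lemma ip_sub_le (x y z w : H) :
  cabs (ip x y - ip z w) <= nm (x - z) * nm y + nm z * nm (y - w).
Proof.
have -> : ip x y - ip z w = ip (x - z) y + ip z (y - w).
  by rewrite (ipBl Hip) (ipBr Hip) addrA subrK.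
apply: le_trans (cabsD _ _) _.
by apply: lerD; apply: cauchy_schwarz.
Qed.

Lemma contC_ip f g : contH f -> contH g -> contC (fun t => ip (f t) (g t)).
Proof.
move=> hf hg t It e e0.
have K0 : 0 <= nm (f t) + nm (g t) + 1 by rewrite !addr_ge0 ?nm_ge0.
have [m /andP[m0 m1] hm] := small_factor K0 e0.
apply: nearI_sub (nearI_and (hf t It _ m0) (hg t It _ m0)) => s Is [h1 h2].
apply: le_lt_trans (ip_sub_le _ _ _ _) _.
have := nmD Hip (g s - g t) (g t); rewrite subrK.
have := nm_ge0 ip (f s - f t); have := nm_ge0 ip (g s - g t).
have := nm_ge0 ip (f t); have := nm_ge0 ip (g t); have := nm_ge0 ip (g s).
nra.
Qed.

Lemma bounded_opB T x y : bounded_op ip T -> T (x - y) = T x - T y.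
Proof. by move=> [h _]; rewrite -scaleN1r addrC h scaleN1r addrC. Qed.

Lemma bounded_op_pos T : bounded_op ip T ->
  exists2 K : R, 0 < K & forall x, nm (T x) <= K * nm x.
Proof.
move=> [_ [K hK]]; exists (`|K| + 1); first by rewrite ltr_wpDl.
move=> x; apply: le_trans (hK x) _.
have := ler_norm K; have := nm_ge0 ip x; nra.
Qed.

Lemma contH_op (A : R -> H -> H) f : (forall t, I01 t -> bounded_op ip (A t)) ->
  contOp ip A -> contH f -> contH (fun t => A t (f t)).
Proof.
move=> HA Ac hf t It e e0.
have [K K0 hK] := bounded_op_pos (HA t It).
have K1 : 0 <= K + nm (f t) + 1 by have := nm_ge0 ip (f t); lra.
have [m /andP[m0 m1] hm] := small_factor K1 e0.
apply: nearI_sub (nearI_and (Ac t It _ m0) (hf t It _ m0)) => s Is [h1 h2].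
apply: le_lt_trans (nm_tri Hip _ (A t (f s)) _) _.
rewrite -(bounded_opB _ _ (HA t It)).
have := hK (f s - f t); have := h1 (f s).
have := nmD Hip (f s - f t) (f t); rewrite subrK.
have := nm_ge0 ip (f s); have := nm_ge0 ip (f s - f t).
have := nm_ge0 ip (f t).
nra.
Qed.

Lemma contH_unif_lim (u : R -> H) :
  (forall e, 0 < e -> exists2 f, contH f & forall t, I01 t -> nm (u t - f t) <= e) ->
  contH u.
Proof.
move=> h t It e e0; have e4 : 0 < e / 4 by lra.
have [f fc hf] := h _ e4.
apply: nearI_sub (fc t It _ e4) => s Is h1.
have := nm_tri Hip (u s) (f s) (u t); have := nm_tri Hip (f s) (f t) (u t).
have := hf s Is; have := hf t It; rewrite (nmBC Hip (u t)); lra.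
Qed.

End HilbertContinuity.

(** * Bessel's inequality and the weak convergence of orthonormal sequences to 0 *)

Section OrthonormalSequences.
Local Open Scope complex_scope.
Variables (R : realType) (H : lmodType R[i]) (ip : H -> H -> R[i]).
Hypothesis Hip : inner_product ip.
Local Notation nm := (hnorm ip).

(** Covers both <x, z> and <T x, z> as functions of x, so that Bessel's inequality applies to the
    second without an adjoint of T. *)
Definition bounded_functional (g : H -> R[i]) : Prop :=
  (forall a x y, g (a *: x + y) = a * g x + g y) /\
  exists K : R, forall x, cabs (g x) <= K * nm x.

Lemma ip_bounded_functional z : bounded_functional (fun x => ip x z).
Proof.
split=> [a x y|]; first exact: ip_lin.
by exists (nm z) => x; rewrite mulrC; apply: cauchy_schwarz.
Qed.

Lemma ip_op_bounded_functional T z : bounded_op ip T ->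
  bounded_functional (fun x => ip (T x) z).
Proof.
move=> [Tlin [K hK]]; split=> [a x y|]; first by rewrite Tlin ip_lin.
exists (nm z * K) => x; apply: le_trans (cauchy_schwarz Hip _ _) _.
by rewrite mulrC -mulrA ler_wpM2l ?nm_ge0.
Qed.

Lemma orthonormal_nm u n : Defs.orthonormal ip u -> nm (u n) = 1.
Proof. by move=> ou; rewrite /hnorm ou eqxx sqrtr1. Qed.

(* Evaluating g at x = \sum conj(g (u n)) u n gives g x = |x|^2 = \sum |g (u n)|^2. *)
Lemma bessel g u : bounded_functional g -> Defs.orthonormal ip u ->
  exists B : R, forall m : nat, \sum_(n < m) cabs (g (u n)) ^+ 2 <= B.
Proof.
move=> [glin [K hK]] ou; exists (K ^+ 2) => m.
pose x m := \sum_(n < m) conjc (g (u n)) *: u n.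
have g0 : g 0 = 0.
  have := glin 1 0 0; rewrite scaler0 addr0 mul1r => /eqP.
  by rewrite -subr_eq0 opprD addrA subrr add0r oppr_eq0 => /eqP.
(* Orthogonality of [x m] to all later [u k] is carried along because Pythagoras needs it at each
   step of the induction. *)
have [gx [nx _]] : g (x m) = (\sum_(n < m) cabs (g (u n)) ^+ 2)%:C /\
    nm (x m) ^+ 2 = \sum_(n < m) cabs (g (u n)) ^+ 2 /\
    forall k, (m <= k)%N -> ip (x m) (u k) = 0.
  elim: m => [|m [IH1 [IH2 IH3]]].
    rewrite /x !big_ord0 g0 nm0 // expr0n /=; split=> //; split=> // k _; exact: ip0l.
  rewrite /x !big_ord_recr /= -/(x m) addrC glin IH1; split; [|split].
  - by rewrite [in RHS]rmorphD /= [in RHS]cabs_sqr addrC (mulrC (conjc _)).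
  - rewrite addrC nmD_sqr // IH2 (ipZr Hip) IH3 // mulr0 /= mulr0 addr0.
    by rewrite nmZ // cabs_conjc orthonormal_nm // mulr1.
  - move=> k mk; rewrite (ip_lin Hip) IH3 ?(ltnW mk) // ou.
    by rewrite (ltn_eqF mk) mulr0 addr0.
have := hK (x m); rewrite gx cabs_real; have := nm_ge0 ip (x m).
rewrite -nx normrX ger0_norm ?nm_ge0 //.
have : 0 <= nm (x m) by exact: nm_ge0.
move: (nm (x m)) => y y0 _ hy.
have [-> |yn0] := eqVneq y 0; first by rewrite expr0n sqr_ge0.
have ypos : 0 < y by rewrite lt_def yn0.
have yK : y <= K by move: hy; rewrite expr2 ler_pM2r.
by nra.
Qed.

Definition eventually (Q : nat -> Prop) : Prop :=
  exists N : nat, forall n, (N <= n)%N -> Q n.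

Lemma eventually_and Q Q' :
  eventually Q -> eventually Q' -> eventually (fun n => Q n /\ Q' n).
Proof.
move=> [a ha] [b hb]; exists (maxn a b) => n; rewrite geq_max => /andP[? ?].
by split; [apply: ha | apply: hb].
Qed.

(** If f n >= e kept recurring, some partial sum would reach k e for every k, beyond the bound B. *)
Lemma bounded_sums_cvg0 (f : nat -> R) (B : R) : (forall n, 0 <= f n) ->
  (forall m : nat, \sum_(n < m) f n <= B) ->
  forall e : R, 0 < e -> eventually (fun n => f n < e).
Proof.
move=> f0 hB e e0; apply: contrapT => /forallNP nev.
pose S m := \sum_(n < m) f n.
have mono N k : S N <= S (N + k)%N.
  elim: k => [|k IH]; first by rewrite addn0.
  by rewrite addnS [S _.+1]big_ord_recr /= -/(S _); apply: le_trans IH _; rewrite lerDl.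
have large k : exists m, k%:R * e <= S m.
  elim: k => [|k [N hN]]; first by exists 0%N; rewrite /S big_ord0 mul0r.
  have [n /not_implyP[Nn /negP]] := (existsNP _).2 (nev N).
  rewrite -leNgt => fn; exists n.+1.
  rewrite [S _.+1]big_ord_recr /= -/(S n) -natr1 mulrDl mul1r lerD //.
  by apply: le_trans hN _; rewrite -(subnKC Nn).
have [m hm] := large (Num.bound (B / e)).
have := le_trans hm (hB m); rewrite -ler_pdivlMr // leNgt.
have B0 : 0 <= B by have := hB 0%N; rewrite big_ord0.
by rewrite archi_boundP // divr_ge0 // ltW.
Qed.

Lemma functional_cvg0 g u : bounded_functional g -> Defs.orthonormal ip u ->
  forall e : R, 0 < e -> eventually (fun n => cabs (g (u n)) < e).
Proof.
move=> bg ou e e0; have [B hB] := bessel bg ou.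
have sq0 n : 0 <= cabs (g (u n)) ^+ 2 by rewrite sqr_ge0.
have [N hN] := bounded_sums_cvg0 sq0 hB (exprn_gt0 2 e0).
by exists N => n /hN; rewrite ltr_pXn2r // nnegrE ?cabs_ge0 // ltW.
Qed.

(** A late term of the orthonormal sequence that realises l works, since <u n, z> and <T (u n), z>
    tend to 0 for each of the finitely many z. *)
Lemma pick_vector (M : set H) (P T : H -> H) (l : R[i]) (zs : seq H) (e : R) :
  orth_proj ip M P -> bounded_op ip T -> We ip M (fun x => P (T x)) l -> 0 < e ->
  exists w, [/\ M w, nm w = 1, cabs (ip (T w) w - l) < e &
    forall z, z \in zs -> cabs (ip w z) < e /\ cabs (ip (T w) z) < e].
Proof.
move=> HP bT [u [uM [ou cv]]] e0.
have evz : eventually (fun n => forall z, z \in zs ->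
    cabs (ip (u n) z) < e /\ cabs (ip (T (u n)) z) < e).
  elim: zs => [|z zs IH]; first by exists 0%N.
  have h1 := functional_cvg0 (ip_bounded_functional z) ou e0.
  have h2 := functional_cvg0 (ip_op_bounded_functional z bT) ou e0.
  have [N hN] := eventually_and IH (eventually_and h1 h2).
  exists N => n /hN[hz [? ?]] y; rewrite inE => /orP[/eqP -> //|]; exact: hz.
have [N hN] := eventually_and evz (cv e e0).
have [hz hl] := hN N (leqnn N).
exists (u N); split=> //; first exact: orthonormal_nm.
(* On vectors of M the compression has the same quadratic form as T, because T x - P (T x) is
   orthogonal to M. *)
suff -> : ip (T (u N)) (u N) = ip (P (T (u N))) (u N) by [].
have [_ orth] := HP (T (u N)); apply/eqP; rewrite -subr_eq0 -(ipBl Hip).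
by rewrite orth.
Qed.

End OrthonormalSequences.

(** * Continuous paths in M that nearly realise a prescribed value of the form *)

Section ApproximatePath.
Local Open Scope complex_scope.
Variables (R : realType) (H : lmodType R[i]) (ip : H -> H -> R[i]).
Hypothesis Hip : inner_product ip.
Local Notation nm := (hnorm ip).
Local Notation contH := (contH ip).

(** Up to e, w is a unit vector orthogonal to x with form value l, and the cross terms of the form
    between w and x vanish. The norm is only nearly 1 because rotating between almost orthogonal
    unit vectors does not preserve it exactly. *)
Definition approx (T : H -> H) (x : H) (l : R[i]) (e : R) (w : H) : Prop :=
  [/\ `|nm w ^+ 2 - 1| <= e, cabs (ip w x) <= e, cabs (ip w (T x)) <= e,
      cabs (ip (T w) x) <= e & cabs (ip (T w) w - l) <= e].

Lemma approx_le T x l e e' w : e <= e' -> approx T x l e w -> approx T x l e' w.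
Proof. by move=> ee [*]; split; apply: le_trans ee. Qed.

Lemma cabs_le_of_dist (a b : R[i]) (h e : R) :
  cabs (a - b) <= h -> cabs b <= e -> cabs a <= e + h.
Proof. by move=> h1 h2; have := cabsD (a - b) b; rewrite subrK; lra. Qed.

Lemma approx_perturb T x l T' x' l' e h w : nm w = 1 -> 0 <= h ->
  cabs (ip w x' - ip w x) <= h -> cabs (ip w (T' x') - ip w (T x)) <= h ->
  cabs (ip (T' w) x' - ip (T w) x) <= h ->
  cabs (ip (T' w) w - l' - (ip (T w) w - l)) <= h ->
  approx T x l e w -> approx T' x' l' (e + h) w.
Proof.
move=> w1 h0 d1 d2 d3 d4 [a0 a1 a2 a3 a4]; split.
- by apply: le_trans a0 _; lra.
- exact: cabs_le_of_dist d1 a1.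
- exact: cabs_le_of_dist d2 a2.
- exact: cabs_le_of_dist d3 a3.
- exact: cabs_le_of_dist d4 a4.
Qed.

Lemma op_ipD T (a b : R) x y z : bounded_op ip T ->
  ip (T (a%:C *: x + b%:C *: y)) z = a%:C * ip (T x) z + b%:C * ip (T y) z.
Proof.
move=> [Tl _]; rewrite Tl (ip_lin Hip); congr (_ + _).
have T0 : T 0 = 0.
  by have /eqP := Tl 1 0 0; rewrite scaler0 addr0 scale1r -subr_eq0 opprD addrA subrr
    add0r oppr_eq0 => /eqP.
by rewrite -{1}(addr0 (_ *: y)) Tl T0 addr0 (ipZl Hip).
Qed.

Lemma cabs_comb (p q e : R) (z w : R[i]) : 0 <= p -> 0 <= q ->
  cabs z <= e -> cabs w <= e -> cabs (p%:C * z + q%:C * w) <= (p + q) * e.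
Proof.
move=> p0 q0 hz hw; apply: le_trans (cabsD _ _) _.
rewrite !cabsM !cabs_real !ger0_norm //; nra.
Qed.

Lemma quadratic_form_comb T (p q : R) x y : bounded_op ip T ->
  ip (T (p%:C *: x + q%:C *: y)) (p%:C *: x + q%:C *: y) =
  (p ^+ 2)%:C * ip (T x) x + (p * q)%:C * (ip (T x) y + ip (T y) x) +
  (q ^+ 2)%:C * ip (T y) y.
Proof.
move=> bT; rewrite op_ipD // !(ipDr Hip) !(ipZr Hip) !conjc_real.
have realM (r1 r2 : R) : (r1 * r2)%:C = r1%:C * r2%:C by exact: rmorphM.
rewrite !expr2 !realM; move: p%:C q%:C (ip _ _) (ip _ _) (ip _ _) (ip _ _).
by move=> *; ring.
Qed.

Lemma Re_comb (p : R) (z : R[i]) : complex.Re (p%:C * z) = p * complex.Re z.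
Proof. by case: z => a b /=; rewrite mul0r subr0. Qed.

Lemma nm_comb_sqr (p q : R) x y : nm (p%:C *: x + q%:C *: y) ^+ 2 =
  p ^+ 2 * nm x ^+ 2 + 2 * (p * q) * complex.Re (ip x y) + q ^+ 2 * nm y ^+ 2.
Proof.
rewrite nmD_sqr // !nmZr // !exprMn !real_normK ?num_real // (ipZl Hip) (ipZr Hip) conjc_real.
by rewrite !Re_comb; ring.
Qed.

(** Since p^2 + q^2 = 1, the form at the combination is a convex combination of two values near l
    plus cross terms, which h controls through 2 p q <= 1. The entries linear in w grow by at most p
    + q <= 2. *)
Lemma approx_comb T x l (e h p q : R) w w' : bounded_op ip T -> 0 <= e ->
  nm w = 1 -> nm w' = 1 -> approx T x l e w -> approx T x l e w' ->
  cabs (ip w' w) <= h -> cabs (ip (T w) w') <= h -> cabs (ip (T w') w) <= h ->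
  0 <= p -> 0 <= q -> p ^+ 2 + q ^+ 2 = 1 ->
  approx T x l (2 * e + h) (p%:C *: w + q%:C *: w').
Proof.
move=> bT e0 w1 w1' [_ b1 b2 b3 b4] [_ c1 c2 c3 c4] h1 h2 h3 p0 q0 pq.
have h0 : 0 <= h by apply: le_trans h1; exact: cabs_ge0.
have pq2 : 2 * (p * q) <= 1 by have := sqr_ge0 (p - q); nra.
have pqs : p + q <= 2 by have := sqr_ge0 (p + q - 2); nra.
have pq0 : 0 <= p * q by exact: mulr_ge0.
have lin (z z' : R[i]) : cabs z <= e -> cabs z' <= e ->
    cabs (p%:C * z + q%:C * z') <= 2 * e + h.
  move=> hz hz'; apply: le_trans (cabs_comb p0 q0 hz hz') _; nra.
split.
- have hR : `|complex.Re (ip w w')| <= h.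
    by apply: le_trans (Re_le_cabs _) _; rewrite (ip_conj Hip w' w) cabs_conjc.
  rewrite nm_comb_sqr w1 w1' !expr1n !mulr1.
  have -> : p ^+ 2 + 2 * (p * q) * complex.Re (ip w w') + q ^+ 2 - 1 =
     2 * (p * q) * complex.Re (ip w w') by rewrite -pq; ring.
  rewrite normrM ger0_norm ?mulr_ge0 //.
  have : 0 <= `|complex.Re (ip w w')| by []. nra.
- rewrite (ipDl Hip) !(ipZl Hip); exact: lin.
- rewrite (ipDl Hip) !(ipZl Hip); exact: lin.
- rewrite op_ipD //; exact: lin.
- rewrite quadratic_form_comb //.
  have -> : (p ^+ 2)%:C * ip (T w) w + (p * q)%:C * (ip (T w) w' + ip (T w') w) +
      (q ^+ 2)%:C * ip (T w') w' - l =
    (p * q)%:C * (ip (T w) w' + ip (T w') w) + ((p ^+ 2)%:C * (ip (T w) w - l) +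
      (q ^+ 2)%:C * (ip (T w') w' - l)).
    have {1}-> : l = (p ^+ 2 + q ^+ 2)%:C * l by rewrite pq mul1r.
    by rewrite rmorphD /=; ring.
  apply: le_trans (cabsD _ _) _.
  have := cabs_comb (sqr_ge0 p) (sqr_ge0 q) b4 c4; rewrite pq mul1r.
  rewrite cabsM cabs_real ger0_norm //.
  have := cabsD (ip (T w) w') (ip (T w') w).
  have := cabs_ge0 (ip (T w) w' + ip (T w') w).
  nra.
Qed.

Variables (A : R -> H -> H) (v : R -> H) (lam : R -> R[i]).
Hypotheses (HA : forall t, I01 t -> bounded_op ip (A t)) (Ac : contOp ip A).
Hypotheses (vc : contH v) (v1 : forall t, I01 t -> nm (v t) = 1) (lc : contC lam).

Local Notation approx_at t := (approx (A t) (v t) (lam t)).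

(** The neighbourhood serves all unit vectors w at once, and both directions hold, so an
    approximation at one nearby parameter can be carried through t to another. *)
Lemma approx_locally_stable t (h : R) : I01 t -> 0 < h ->
  nearI t (fun s => forall w e, nm w = 1 ->
    (approx_at t e w -> approx_at s (e + h) w) /\
    (approx_at s e w -> approx_at t (e + h) w)).
Proof.
move=> It h0; have [K K0 hK] := bounded_op_pos (HA It).
(* This covers the change m (1 + K) of <A w, v> as well as the change 2 m of <A w, w> - lam. *)
have K2 : 0 <= K + 2 by lra.
have [m /andP[m0 m1] hm] := small_factor K2 h0.
have mh : m * (1 + K) < h by nra.
have avc := contH_op Hip HA Ac vc.
apply: nearI_sub (nearI_and (nearI_and (vc It m0) (avc t It m m0))
                            (nearI_and (Ac It m0) (lc It m0))).
move=> s Is [[d1 d2] [d3 d4]] w e w1.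
have e1 : cabs (ip w (v s) - ip w (v t)) <= h.
  rewrite -(ipBr Hip); apply: le_trans (cauchy_schwarz Hip _ _) _; rewrite w1; nra.
have e2 : cabs (ip w (A s (v s)) - ip w (A t (v t))) <= h.
  rewrite -(ipBr Hip); apply: le_trans (cauchy_schwarz Hip _ _) _; rewrite w1; nra.
have e3 : cabs (ip (A s w) (v s) - ip (A t w) (v t)) <= h.
  apply: le_trans (ip_sub_le Hip _ _ _ _) _; rewrite v1 //.
  have := d3 w; have := hK w; rewrite w1.
  have := nm_ge0 ip (v s - v t); have := nm_ge0 ip (A t w); nra.
have e4 : cabs (ip (A s w) w - lam s - (ip (A t w) w - lam t)) <= h.
  have -> : ip (A s w) w - lam s - (ip (A t w) w - lam t) =
    ip (A s w - A t w) w - (lam s - lam t) by rewrite (ipBl Hip); ring.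
  apply: le_trans (cabsB _ _) _.
  have := cauchy_schwarz Hip (A s w - A t w) w; have := d3 w; rewrite w1; nra.
have h0' := ltW h0; split; apply: approx_perturb => //; by rewrite cabsBC.
Qed.

Variables (M : set H) (P : H -> H).
Hypotheses (HMs : is_subspace M) (HP : orth_proj ip M P).
Hypothesis HW : forall t, I01 t -> We ip M (fun x => P (A t x)) (lam t).

Lemma subspaceD a b x y : M x -> M y -> M (a *: x + b *: y).
Proof.
move=> Mx My; have [M0 ML] := HMs; apply: (ML) => //.
by rewrite -(addr0 (b *: y)); apply: ML.
Qed.

(* The path is extended past t by rotating its current endpoint w towards a vector w'
   that is almost orthogonal to w, A t w, v t and A t (v t). *)
Lemma approx_path (e : R) : 0 < e ->
  exists W, [/\ contH W, forall t, I01 t -> M (W t) &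
    forall t, I01 t -> approx_at t e (W t)].
Proof.
move=> e0.
(* The path is good up to x and then stays at a unit vector w, whose error e / 4 at x is stricter
   than required: the slack is spent on the next rotation. *)
pose Q x := exists W w, [/\ contH W, forall s, I01 s -> M (W s), M w /\ nm w = 1,
  forall s, I01 s -> x <= s -> W s = w &
  approx_at x (e / 4) w /\ forall s, I01 s -> s <= x -> approx_at s e (W s)].
suff [W [w [Wc WM _ _ [_ hW]]]] : Q 1.
  by exists W; split=> // t It; apply: hW => //; case/andP: It.
have h0 : 0 < e / 16 by lra.
have unit_approx t w (zs : seq H) : nm w = 1 -> {subset [:: v t; A t (v t)] <= zs} ->
    cabs (ip (A t w) w - lam t) < e / 16 ->
    (forall z, z \in zs -> cabs (ip w z) < e / 16 /\ cabs (ip (A t w) z) < e / 16) ->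
    approx_at t (e / 16) w.
  move=> w1 sub wl hz.
  have [h1 h2] := hz (v t) (sub _ (mem_head _ _)).
  have [h3 h4] : _ /\ _ := hz (A t (v t)) (sub _ (mem_last _ _)).
  by split; rewrite ?w1 ?expr1n ?subrr ?normr0 ltW.
apply: real_induction.
  have I0 : I01 (0 : R) by apply/andP; split; lra.
  have [w [Mw w1 wl hz]] := pick_vector Hip [:: v 0; A 0 (v 0)] HP (HA I0) (HW I0) h0.
  have w0 := unit_approx 0 w _ w1 (fun z hz => hz) wl hz.
  exists (fun _ => w), w; split=> //; first exact: contH_const.
  split; first by apply: approx_le w0; lra.
  move=> s /andP[s0 _] s0'; have -> : s = 0 by apply/le_anti/andP.
  by apply: approx_le w0; lra.
move=> t It.
have [del del0 hdel] := nearI_and (approx_locally_stable It h0) (Ac It h0).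
exists del => // x y Ix Iy hx hy xy [W [w [Wc WM [Mw w1] Ww [wx hW]]]].
have [w' [Mw' w1' wl' hz]] :=
  pick_vector Hip [:: v t; A t (v t); w; A t w] HP (HA It) (HW It) h0.
have w't : approx_at t (e / 16) w'.
  by apply: unit_approx hz => // z; rewrite !inE => /orP[->|->]; rewrite ?orbT.
have [zw zTw] : cabs (ip w' w) < e / 16 /\ cabs (ip (A t w') w) < e / 16.
  by apply: hz; rewrite !inE eqxx !orbT.
have [zAw _] := hz (A t w) (mem_last (v t) [:: _; _; _]).
have [stab_x _] := hdel x Ix hx; have [stab_y _] := hdel y Iy hy.
have wt := (stab_x w (e / 4) w1).2 wx.
pose r := ramp x y.
have r0 s : 0 <= r s := ramp_ge0 x y s.
have r1 s : 0 <= 1 - r s by rewrite subr_ge0; apply: ramp_le1.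
have rc : contR r := ramp_cont xy.
(* The old path is untouched before x and the value is w' after y; on [x, y], where W is constantly
   w, the squares of the weights add to 1. *)
pose W' s := (Num.sqrt (1 - r s))%:C *: W s + (Num.sqrt (r s))%:C *: w'.
have W'_left s : s <= x -> W' s = W s.
  by move=> sx; rewrite /W' /r ramp_left // subr0 sqrtr1 sqrtr0 scale1r scale0r addr0.
have W'_right s : y <= s -> W' s = w'.
  by move=> ys; rewrite /W' /r ramp_right // subrr sqrtr1 sqrtr0 scale1r scale0r add0r.
exists W', w'; split.
- apply: contHD => //; apply: contHZ => //; try exact: contH_const.
    apply: contR_sqrt => // a Ia b b0; apply: nearI_sub (rc a Ia b b0) => s _.
    have -> : 1 - r s - (1 - r a) = - (r s - r a) by ring.
    by rewrite normrN.
  exact: contR_sqrt.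
- by move=> s Is; apply: subspaceD => //; apply: WM.
- by [].
- by move=> s _; apply: W'_right.
- split; first by apply: approx_le ((stab_y w' _ w1').1 w't); lra.
  move=> s Is sy; have [sx|xs] := leP s x; first by rewrite W'_left //; apply: hW.
  have hs : `|s - t| < del.
    by move: hx hy; rewrite !ltr_norml => /andP[? ?] /andP[? ?]; apply/andP; split; lra.
  have [stab_s op_s] := hdel s Is hs.
  (* The cross terms were made small for A t only; passing to A s adds another e / 16. *)
  have cross (x1 x2 : H) : nm x1 = 1 -> nm x2 = 1 -> cabs (ip (A t x1) x2) <= e / 16 ->
      cabs (ip (A s x1) x2) <= e / 8.
    move=> n1 n2 hc; have := cauchy_schwarz Hip (A s x1 - A t x1) x2.
    rewrite (ipBl Hip) n2 mulr1 => hd; have := op_s x1; rewrite n1 mulr1 => hd'.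
    have := cabs_le_of_dist (le_trans hd hd') hc; lra.
  rewrite /W' Ww ?(ltW xs) //.
  have a1 : approx_at s (3 * e / 8) w.
    by apply: approx_le ((stab_s w _ w1).1 wt); lra.
  have a2 : approx_at s (3 * e / 8) w'.
    by apply: approx_le ((stab_s w' _ w1').1 w't); lra.
  (* The error e / 4 of w at x grows by e / 16 on the way to t and again on the way to s, giving 3 e
     / 8; with cross terms of size e / 8 the total is 7 e / 8. *)
  apply: (@approx_le _ _ _ (2 * (3 * e / 8) + e / 8)); first by lra.
  apply: approx_comb => //; try exact: sqrtr_ge0.
  + exact: HA.
  + by lra.
  + by apply: le_trans (ltW zw) _; lra.
  + apply: cross => //; rewrite (ip_conj Hip w') cabs_conjc; exact: ltW.
  + by apply: cross => //; apply: ltW.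
  + by rewrite !sqr_sqrtr // subrK.
Qed.

End ApproximatePath.

(** * One correction of v towards the exact value d *)

Section Correction.
Local Open Scope complex_scope.
Variables (R : realType) (H : lmodType R[i]) (ip : H -> H -> R[i]).
Hypothesis Hip : inner_product ip.
Local Notation nm := (hnorm ip).
Local Notation contH := (contH ip).

Lemma quadratic_form_scale T (k : R) x : bounded_op ip T ->
  ip (T (k%:C *: x)) (k%:C *: x) = (k ^+ 2)%:C * ip (T x) x.
Proof.
move=> bT; have := quadratic_form_comb Hip k 0 x x bT.
rewrite scale0r addr0 mulr0 expr0n /= !mul0r !addr0; exact.
Qed.

(** These are the cosine and sine of the angle with tangent 2 rho. For rho^2 = eps / theta the
    factor (4 rho^2)^-1 is theta / (4 eps). *)
Lemma rotation_coefs (rho : R) : 0 < rho -> exists c s : R,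
  [/\ 0 < c, 0 < s, c ^+ 2 + s ^+ 2 = 1, s <= 2 * rho & s ^+ 2 * (4 * rho ^+ 2)^-1 = c ^+ 2].
Proof.
move=> r0; have q0 : 0 < 1 + 4 * rho ^+ 2 by have := sqr_ge0 rho; lra.
pose c := (Num.sqrt (1 + 4 * rho ^+ 2))^-1; exists c, (2 * rho * c).
have c0 : 0 < c by rewrite invr_gt0 sqrtr_gt0.
have c2 : c ^+ 2 * (1 + 4 * rho ^+ 2) = 1.
  by rewrite exprVn sqr_sqrtr ?ltW // mulVf // lt0r_neq0.
clearbody c; split=> //.
- by rewrite !mulr_gt0.
- by rewrite -[RHS]c2; ring.
- have c1 : c <= 1 by have := sqr_ge0 (c * rho); nra.
  nra.
- by field; rewrite lt0r_neq0.
Qed.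

(* The choice of kappa makes c^2 <T v, v> + s^2 (d + kappa (d - <T v, v>)) equal to d. *)
Lemma correct_vector T (v w : H) (d : R[i]) (c s kappa e : R) : bounded_op ip T ->
  nm v = 1 -> 0 < c -> 0 < s -> c ^+ 2 + s ^+ 2 = 1 -> s ^+ 2 * kappa = c ^+ 2 ->
  0 <= e -> e <= 1 / 8 -> approx ip T v (d + kappa%:C * (d - ip (T v) v)) e w ->
  let u0 := c%:C *: v + s%:C *: w in let u := ((nm u0)^-1)%:C *: u0 in
  [/\ 1 / 2 <= nm u0, nm u = 1,
      cabs (ip (T u) u - d) <= 6 * e * (1 + cabs d) & nm (u - v) <= 2 * s + 3 * e].
Proof.
move=> bT v1 c0 s0 cs ks e0 e8 [w1 b1 b2 b3 b4] u0 u.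
have c1 : c <= 1 by have := sqr_ge0 s; nra.
have s1 : s <= 1 by have := sqr_ge0 c; nra.
have cs2 : 2 * (c * s) <= 1 by have := sqr_ge0 (c - s); nra.
have cs0 : 0 <= c * s by rewrite mulr_ge0 // ltW.
have N1 : `|nm u0 ^+ 2 - 1| <= 2 * e.
  rewrite /u0 nm_comb_sqr // v1.
  have -> : c ^+ 2 * 1 ^+ 2 + 2 * (c * s) * complex.Re (ip v w) + s ^+ 2 * nm w ^+ 2 - 1 =
    2 * (c * s) * complex.Re (ip v w) + s ^+ 2 * (nm w ^+ 2 - 1).
    have -> : s ^+ 2 = 1 - c ^+ 2 by lra.
    by ring.
  apply: le_trans (ler_normD _ _) _; rewrite (normrM (2 * (c * s))) (normrM (s ^+ 2)).
  have -> : `|2 * (c * s)| = 2 * (c * s) by rewrite ger0_norm // mulr_ge0.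
  have -> : `|s ^+ 2| = s ^+ 2 by rewrite ger0_norm // sqr_ge0.
  have hR : `|complex.Re (ip v w)| <= e.
    by apply: le_trans (Re_le_cabs _) _; rewrite (ip_conj Hip w v) cabs_conjc.
  have : 0 <= `|complex.Re (ip v w)| by [].
  have : 0 <= `|nm w ^+ 2 - 1| by [].
  have : 0 <= s ^+ 2 by exact: sqr_ge0.
  have : s ^+ 2 <= 1 by have := sqr_ge0 c; lra.
  nra.
have err : cabs (ip (T u0) u0 - d) <= 2 * e.
  rewrite /u0 (quadratic_form_comb Hip) //.
  set l := d + _ in b4.
  have -> : (c ^+ 2)%:C * ip (T v) v + (c * s)%:C * (ip (T v) w + ip (T w) v) +
      (s ^+ 2)%:C * ip (T w) w - d =
    (c * s)%:C * (ip (T v) w + ip (T w) v) + (s ^+ 2)%:C * (ip (T w) w - l).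
    have realM (r1 r2 : R) : (r1 * r2)%:C = r1%:C * r2%:C by exact: rmorphM.
    have realD (r1 r2 : R) : (r1 + r2)%:C = r1%:C + r2%:C by exact: rmorphD.
    have E1 : (s ^+ 2)%:C * kappa%:C = (c ^+ 2)%:C by rewrite -realM ks.
    have E2 : (c ^+ 2)%:C + (s ^+ 2)%:C = 1 by rewrite -realD cs.
    (* The main terms cancel exactly, which leaves only the cross terms and the error of w. *)
    have E3 : (s ^+ 2)%:C * l = d - (c ^+ 2)%:C * ip (T v) v.
      rewrite /l mulrDr mulrA E1 -{3}(mul1r d) -E2; move: (c ^+ 2)%:C (s ^+ 2)%:C (ip _ _).
      by move=> *; ring.
    rewrite mulrBr E3; move: (c ^+ 2)%:C (s ^+ 2)%:C (c * s)%:C (ip _ _) (ip _ _) (ip _ _).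
    by move=> *; ring.
  apply: le_trans (cabsD _ _) _; rewrite !cabsM !cabs_real !ger0_norm ?sqr_ge0 //.
  have := cabsD (ip (T v) w) (ip (T w) v).
  rewrite (ip_conj Hip w (T v)) cabs_conjc => hD.
  have := cabs_ge0 (conjc (ip w (T v)) + ip (T w) v).
  have := cabs_ge0 (ip (T w) w - l).
  have : 0 <= s ^+ 2 by exact: sqr_ge0.
  have : s ^+ 2 <= 1 by have := sqr_ge0 c; lra.
  nra.
have n0 : 0 <= nm u0 by exact: nm_ge0.
have nge : 1 / 2 <= nm u0 by move: N1; rewrite ler_norml => /andP[? _]; nra.
have nn0 : nm u0 != 0 by rewrite lt0r_neq0 //; lra.
split=> //.
- by rewrite nmZr // ger0_norm ?invr_ge0 // mulVf.
- rewrite /u quadratic_form_scale //; set k := (nm u0)^-1.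
  have kn : k ^+ 2 * nm u0 ^+ 2 = 1 by rewrite -exprMn mulVf // expr1n.
  have k2 : k ^+ 2 <= 2.
    move: N1; rewrite ler_norml => /andP[? _]; have := sqr_ge0 k; nra.
  (* Normalising shifts the target by a multiple of (|u0|^2 - 1) d, which is why |d| enters the
     bound. *)
  have -> : (k ^+ 2)%:C * ip (T u0) u0 - d =
      (k ^+ 2)%:C * ((ip (T u0) u0 - d) - (nm u0 ^+ 2 - 1)%:C * d).
    have E : (k ^+ 2)%:C * (nm u0 ^+ 2 - 1)%:C = 1 - (k ^+ 2)%:C.
      have -> : 1 = 1%:C :> R[i] by [].
      by rewrite -rmorphM -rmorphB mulrBr kn mulr1.
    rewrite mulrBr mulrA E; move: (ip _ _) (k ^+ 2)%:C => *; ring.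
  rewrite cabsM cabs_real ger0_norm ?sqr_ge0 //.
  have h1 : cabs (ip (T u0) u0 - d - (nm u0 ^+ 2 - 1)%:C * d) <= 2 * e + 2 * e * cabs d.
    apply: le_trans (cabsB _ _) _; rewrite cabsM cabs_real.
    by apply: lerD => //; apply: ler_wpM2r => //; apply: cabs_ge0.
  have := cabs_ge0 (ip (T u0) u0 - d - (nm u0 ^+ 2 - 1)%:C * d).
  have h2 : 0 <= e * cabs d by rewrite mulr_ge0 ?cabs_ge0.
  have := sqr_ge0 k; move: h1; move: (cabs _) (k ^+ 2) k2 => X K *; nra.
- have d1 : nm (u - u0) <= 2 * e.
    have -> : u - u0 = ((nm u0)^-1 - 1)%:C *: u0.
      by rewrite rmorphB /= scalerBl scale1r.
    rewrite nmZr // -{2}(ger0_norm n0) -normrM mulrBl mulVf // mul1r.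
    apply: le_trans N1; rewrite -[X in _ <= X]normrN opprB.
    have -> : 1 - nm u0 ^+ 2 = (1 - nm u0) * (1 + nm u0) by ring.
    rewrite normrM ler_peMr // ger0_norm; lra.
  have wle : nm w <= 1 + e.
    have w0 := nm_ge0 ip w; move: w1; rewrite ler_norml => /andP[_ ?]; nra.
  have d2 : nm (u0 - v) <= (1 - c) + s * (1 + e).
    have -> : u0 - v = (c - 1)%:C *: v + s%:C *: w.
      by rewrite rmorphB /= scalerBl scale1r addrAC.
    apply: le_trans (nmD Hip _ _) _; rewrite !nmZr // v1 mulr1.
    apply: lerD; first by rewrite distrC ger0_norm // subr_ge0.
    by rewrite gtr0_norm // ler_pM2l.
  (* Hence 1 - c <= s, so u0 is within 2 s + e of v, and normalising adds 2 e. *)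
  have csge : 1 <= c + s by nra.
  have := nm_tri Hip u u0 v; nra.
Qed.

(** The displacement depends only on the old error eps, while the new error delta is arbitrary; this
    lets the corrections be iterated with summable displacements. *)
Lemma correction_step (A : R -> H -> H) (d : R -> R[i]) (v : R -> H) (M : set H)
    (P : H -> H) (eps theta delta : R) :
  (forall t, I01 t -> bounded_op ip (A t)) -> contOp ip A -> contC d ->
  contH v -> (forall t, I01 t -> nm (v t) = 1) ->
  is_subspace M -> orth_proj ip M P ->
  (forall t, I01 t -> forall z, cabs (z - d t) < theta ->
    We ip M (fun x => P (A t x)) z) ->
  0 < eps -> 0 < theta -> 0 < delta ->
  (forall t, I01 t -> cabs (ip (A t (v t)) (v t) - d t) <= eps) ->
  exists u, contH u /\ forall t, I01 t ->
    [/\ nm (u t) = 1, cabs (ip (A t (u t)) (u t) - d t) <= delta,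
        nm (u t - v t) <= 6 * Num.sqrt (eps / theta) &
        exists a m, M m /\ u t = a *: v t + m].
Proof.
move=> HA Ac dc vc v1 HMs HP disc eps0 theta0 delta0 hv.
have r2 : Num.sqrt (eps / theta) ^+ 2 = eps / theta by rewrite sqr_sqrtr // divr_ge0 // ltW.
have r0 : 0 < Num.sqrt (eps / theta) by rewrite sqrtr_gt0 divr_gt0.
move: (Num.sqrt _) r2 r0 => rho r2 r0.
have [c [s [c0 s0 cs s2r sk]]] := rotation_coefs r0.
pose kappa := (4 * rho ^+ 2)^-1.
(* Consequently lam stays within theta / 4 of d, well inside the disc. *)
have kE : kappa * eps = theta / 4.
  by rewrite /kappa r2; field; rewrite !lt0r_neq0.
have kappa0 : 0 <= kappa by rewrite invr_ge0 mulr_ge0 // sqr_ge0.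
pose lam t := d t + kappa%:C * (d t - ip (A t (v t)) (v t)).
have avc := contC_ip Hip (contH_op Hip HA Ac vc) vc.
have lc : contC lam.
  move=> t It e e0; have K0 : 0 <= 1 + 2 * kappa by lra.
  have [m /andP[m0 _] hm] := small_factor K0 e0.
  apply: nearI_sub (nearI_and (dc t It m m0) (avc t It m m0)) => x Ix [h1 h2].
  have -> : lam x - lam t = (d x - d t) + kappa%:C * ((d x - d t) -
     (ip (A x (v x)) (v x) - ip (A t (v t)) (v t))).
    by rewrite /lam; move: (ip _ _) (ip _ _) kappa%:C => *; ring.
  apply: le_lt_trans (cabsD _ _) _; rewrite cabsM cabs_real ger0_norm //.
  have := cabsB (d x - d t) (ip (A x (v x)) (v x) - ip (A t (v t)) (v t)); nra.
have HW t : I01 t -> We ip M (fun x => P (A t x)) (lam t).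
  move=> It; apply: disc => //.
  rewrite /lam addrC addKr cabsM cabs_real ger0_norm //.
  have := hv t It; rewrite cabsBC; nra.
have [B B0 hB] := contC_bounded dc.
have B1 : 0 <= 6 * (1 + B) by lra.
have [m /andP[m0 _] hm] := small_factor B1 delta0.
(* The bound m brings 6 e (1 + B) below delta, 1 / 8 is required by [correct_vector], and rho / 2
   gives 2 s + 3 e <= 4 rho + 3 rho / 2 <= 6 rho. *)
pose e := Num.min m (Num.min (1 / 8) (rho / 2)).
have e0 : 0 < e by rewrite !lt_min m0 /=; apply/andP; split; lra.
have [em e8 er] : [/\ e <= m, e <= 1 / 8 & e <= rho / 2].
  by split; rewrite !ge_min lexx ?orbT.
clearbody e.
have [W [Wc WM hW]] := approx_path Hip HA Ac vc v1 lc HMs HP HW e0.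
pose u0 t := c%:C *: v t + s%:C *: W t.
have main t (It : I01 t) :=
  correct_vector (HA t It) (v1 t It) c0 s0 cs sk (ltW e0) e8 (hW t It).
exists (fun t => ((nm (u0 t))^-1)%:C *: u0 t); split.
  have constR (x : R) : contR (fun _ => x).
    by move=> t _ b b0; exists 1 => // y _ _; rewrite subrr normr0.
  have u0c : contH u0 by apply: contHD => //; apply: contHZ.
  apply: contHZ => //; apply: contR_inv; last exact: contH_nm.
  by move=> t It; have [] := main t It.
move=> t It; have [_ h1 h2 h3] := main t It; split=> //.
- apply: le_trans h2 _; have := hB t It; nra.
- apply: le_trans h3 _; lra.
- exists (((nm (u0 t))^-1)%:C * c%:C), (((nm (u0 t))^-1)%:C *: (s%:C *: W t)).
  rewrite -scalerA -scalerDr; split=> //.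
  rewrite scalerA -[X in M X]addr0 -(scale0r (W t)).
  by apply: subspaceD => //; apply: WM.
Qed.

End Correction.

(** * Discs contained in a plane set, by distance to its boundary *)

Section BoundaryDistance.
Local Open Scope complex_scope.
Variable R : realType.

Lemma distC_le (l z : R[i]) (S : set R[i]) : S z -> distC l S <= cabs (l - z).
Proof.
move=> Sz; apply: ge_inf; last by exists z.
by exists 0 => x [y _ <-]; apply: cabs_ge0.
Qed.

(** The empty set is included thanks to the default value 0 of its [inf]. *)
Lemma inf_ge0 (E : set R) : (forall x, E x -> 0 <= x) -> 0 <= inf E.
Proof.
move=> h; have [-> |ne] := pselect (E = set0); first by rewrite inf0.
by apply: lb_le_inf; [apply/set0P/eqP | move=> x /h].
Qed.

Lemma distC_ge0 (l : R[i]) (S : set R[i]) : 0 <= distC l S.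
Proof. by apply: inf_ge0 => x [y _ <-]; apply: cabs_ge0. Qed.

(* The supremum of the parameters of points of S on the segment gives a boundary point. *)
Lemma disc_subset (S : set R[i]) (l z : R[i]) :
  S l -> cabs (z - l) < distC l (boundaryC S) -> S z.
Proof.
move=> Sl hz; apply: contrapT => nSz.
pose g (x : R) := l + x%:C * (z - l).
have g1 : g 1 = z by rewrite /g mul1r addrC subrK.
have g0 : g 0 = l by rewrite /g mul0r addr0.
have gd x y : cabs (g x - g y) = `|x - y| * cabs (z - l).
  rewrite -cabs_real -cabsM rmorphB /=; congr cabs.
  by rewrite /g; move: x%:C y%:C => *; ring.
pose E := [set x : R | I01 x /\ S (g x)].
have E0 : E 0 by split; rewrite ?g0 //; apply/andP; split; lra.
have hsE : has_sup E by split; [exists 0 | exists 1 => x [/andP[_ ?] _]].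
have s0 : 0 <= sup E by apply: (sup_upper_bound hsE).
have s1 : sup E <= 1 by apply: ge_sup; [exists 0 | move=> x [/andP[_ ?] _]].
have bnd : boundaryC S (g (sup E)).
  move=> r r0; have [m /andP[m0 _] hm] := small_factor (cabs_ge0 (z - l)) r0.
  have c0 := cabs_ge0 (z - l).
  split.
    have [x [Ix Sx] ltx] := sup_adherent m0 hsE; exists (g x); split=> //.
    have xs : x <= sup E by apply: (sup_upper_bound hsE).
    rewrite gd distrC ger0_norm ?subr_ge0 //; nra.
  (* A nearby point outside S is z itself if the supremum is 1, and otherwise a point of the segment
     slightly beyond the supremum. *)
  have [s1'|s1'] := ltP (sup E) 1; last first.
    have -> : sup E = 1 by apply/le_anti/andP.
    by exists z; rewrite g1 subrr cabs0.
  pose y := Num.min 1 (sup E + m).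
  have ys : sup E < y by rewrite lt_min s1' ltrDl.
  have ym : y <= sup E + m by rewrite ge_min lexx orbT.
  have y1 : y <= 1 by rewrite ge_min lexx.
  clearbody y; exists (g y); split; first by rewrite gd ger0_norm ?subr_ge0 ?ltW //; nra.
  move=> Sy; have : y <= sup E by apply: (sup_upper_bound hsE); split=> //; apply/andP; split; lra.
  by rewrite leNgt ys.
have := distC_le l bnd.
have -> : cabs (l - g (sup E)) = sup E * cabs (z - l).
  by rewrite -[in LHS]g0 gd sub0r normrN ger0_norm.
have := cabs_ge0 (z - l); nra.
Qed.

End BoundaryDistance.

(** * Limits of geometrically convergent corrections *)

Section Iteration.
Local Open Scope complex_scope.
Variables (R : realType) (H : lmodType R[i]) (ip : H -> H -> R[i]).
Hypothesis Hip : inner_product ip.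
Local Notation nm := (hnorm ip).
Local Notation contH := (contH ip).
Local Notation q := (4^-1 : R).

Lemma geometric_small (D e : R) : 0 <= D -> 0 < e ->
  exists N : nat, forall n, (N <= n)%N -> D * q ^+ n < e.
Proof.
move=> D0 e0; exists (Num.bound (D / e)) => n hn.
have : D / e < 4 ^+ n.
  apply: lt_le_trans (upper_nthrootP hn) _.
  by apply: lerXn2r; rewrite ?nnegrE //; lra.
by rewrite ltr_pdivrMr // exprVn ltr_pdivrMr ?exprn_gt0 // mulrC.
Qed.

(** Steps of size 3 D / 4^n have tails 4 D / 4^n, since 3 / (1 - 1/4) = 4. The tails are uniform in
    t, so the pointwise limit is continuous. *)
Lemma geometric_limit (f : nat -> R -> H) (D : R) : complete_space ip -> 0 <= D ->
  (forall n, contH (f n)) ->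
  (forall n t, I01 t -> nm (f n.+1 t - f n t) <= 3 * D * q ^+ n) ->
  exists2 u, contH u & forall n t, I01 t -> nm (u t - f n t) <= 4 * D * q ^+ n.
Proof.
move=> complete D0 fc hf.
have qn n : 0 < q ^+ n by rewrite exprn_gt0 // invr_gt0.
have tel n k t : I01 t -> nm (f (n + k)%N t - f n t) <= 4 * D * q ^+ n * (1 - q ^+ k).
  move=> It; elim: k => [|k IH]; first by rewrite addn0 subrr nm0 // subrr mulr0.
  have := nm_tri Hip (f (n + k.+1)%N t) (f (n + k)%N t) (f n t).
  have := hf (n + k)%N t It; rewrite addnS exprS exprD.
  move: IH; move: (nm _) (nm _) (nm _) (q ^+ n) (q ^+ k) => X Y Z a b; lra.
have tail n m t : I01 t -> (n <= m)%N -> nm (f m t - f n t) <= 4 * D * q ^+ n.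
  move=> It nm'; rewrite -(subnKC nm'); apply: le_trans (tel _ _ _ It) _.
  have h0 : 0 <= 4 * D * q ^+ n by apply: mulr_ge0; [lra | exact: ltW].
  rewrite ler_piMr //; have := qn (m - n)%N; lra.
have lim t : exists x, I01 t -> cvgH ip (f^~ t) x.
  (* Outside [0,1] the limit is unconstrained and 0 is a default. *)
  have [It|nIt] := pselect (I01 t); last by exists 0.
  have [|x hx] := complete (f^~ t); last by exists x.
  move=> e e0; have D8 : 0 <= 8 * D by lra.
  have [N hN] := geometric_small D8 e0; exists N => n m Nn Nm.
  have := nm_tri Hip (f n t) (f N t) (f m t); rewrite (nmBC Hip (f N t)).
  have := tail _ _ _ It Nn; have := tail _ _ _ It Nm; have := hN N (leqnn N); lra.
have [u hu] := choice lim.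
have uf n t : I01 t -> nm (u t - f n t) <= 4 * D * q ^+ n.
  move=> It; apply: (nm_le_lim Hip) => e e0; have [N hN] := hu t It e e0.
  exists (f (maxn N n) t); last by apply: tail => //; apply: leq_maxr.
  by rewrite nmBC //; apply: hN; apply: leq_maxl.
exists u => //; apply: contH_unif_lim => // e e0; have D4 : 0 <= 4 * D by lra.
have [N hN] := geometric_small D4 e0.
by exists (f N) => // t It; apply: le_trans (uf N t It) _; apply/ltW/hN.
Qed.

Lemma le0_of_le_pos (x : R) : (forall e, 0 < e -> x <= e) -> x <= 0.
Proof. by move=> h; rewrite leNgt; apply/negP => x0; have := h (x / 2) ltac:(lra); lra. Qed.

Lemma quadratic_form_limit T x (l : R[i]) : bounded_op ip T ->
  (forall e, 0 < e -> exists y, [/\ nm y = 1, nm (x - y) <= e & cabs (ip (T y) y - l) <= e]) ->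
  nm x = 1 /\ ip (T x) x = l.
Proof.
move=> bT h; have x1 : nm x = 1.
  apply/eqP; rewrite -subr_eq0 -normr_le0; apply: le0_of_le_pos => e e0.
  by have [y [<- hy _]] := h e e0; apply: le_trans (nm_dist Hip _ _) hy.
split=> //; apply/eqP; rewrite -subr_eq0; apply/eqP/cabs0_eq0/le_anti/andP.
split; last exact: cabs_ge0.
apply: le0_of_le_pos => e e0; have [K K0 hK] := bounded_op_pos bT.
(* Replacing x by y in both arguments of the form costs 2 K m, and the value at y is within m of
   l. *)
have K1 : 0 <= 2 * K + 1 by lra.
have [m /andP[m0 _] hm] := small_factor K1 e0.
have [y [y1 hy hl]] := h m m0.
have := cabs_tri (ip (T x) x) (ip (T y) y) l.
have := ip_sub_le Hip (T x) x (T y) y; rewrite x1 -(bounded_opB _ _ bT).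
have := hK (x - y); have := hK y; rewrite y1.
have := nm_ge0 ip (x - y); have := nm_ge0 ip (T y); nra.
Qed.

(** Each approximant is a two-term linear combination: a v and m, both with coefficient 1. *)
Lemma clspan_limit (v x : H) (M : set H) :
  (forall e, 0 < e -> exists y, nm (x - y) < e /\ exists a m, M m /\ y = a *: v + m) ->
  clspan ip ([set a *: v | a in [set: R[i]]] `|` M) x.
Proof.
move=> h e e0; have [y [xy [a [m [Mm yE]]]]] := h e e0.
exists (a *: v + m); split; last by rewrite -yE.
exists 2%N, (fun _ => 1), (fun i : 'I_2 => if i == ord0 then a *: v else m); split.
  by move=> i; case: ifP => _; [left; exists a | right].
by rewrite big_ord_recl big_ord1 /= !scale1r.
Qed.

End Iteration.

(** * Iterating the correction and passing to the limit *)

Unset Implicit Arguments.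

Theorem theorem6p3 (R : realType) (H : lmodType R[i]) (ip : H -> H -> R[i])
  (Hip : inner_product ip) (Hcomp : complete_space ip) (Hsep : separable ip)
  (Hinf : ~ finite_dim [set: H])
  (A : R -> H -> H) (HA : forall t, I01 t -> bounded_op ip (A t)) (HAc : contOp ip A)
  (d : R -> R[i]) (Hdc : contC d)
  (Hd : forall t, I01 t -> interiorC (We ip [set: H] (A t)) (d t))
  (theta : R)
  (Htheta : theta = inf [set distC (d t) (boundaryC (We ip [set: H] (A t))) | t in @I01 R])
  (eps : R) (Heps : 0 < eps < theta)
  (v : R -> H) (Hvc : contH ip v) (Hv1 : forall t, I01 t -> hnorm ip (v t) = 1)
  (Hv : forall t, I01 t -> cabs (ip (A t (v t)) (v t) - d t) <= eps)
  (M : set H) (HMs : is_subspace M) (HMc : closedH ip M) (HMi : ~ finite_dim M)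
  (P : H -> H) (HP : orth_proj ip M P)
  (HW : forall t, I01 t -> We ip M (fun x => P (A t x)) = We ip [set: H] (A t)) :
  exists u : R -> H, contH ip u /\
    forall t, I01 t ->
      [/\ ip (A t (u t)) (u t) = d t /\ hnorm ip (u t) = 1,
          hnorm ip (u t - v t) <= 12 * Num.sqrt (eps / theta) &
          clspan ip ([set a *: v t | a in [set: R[i]]] `|` M) (u t)].
Proof.
have [eps0 eps_theta] := andP Heps; have theta0 : 0 < theta by exact: lt_trans eps_theta.
pose q : R := 4^-1; pose rho := Num.sqrt (eps / theta).
have rho0 : 0 <= rho by exact: sqrtr_ge0.
have qn n : 0 < q ^+ n by rewrite exprn_gt0 // invr_gt0.
(* As theta is at most the distance from d t to the boundary, the disc lies in the essential
   numerical range of A t, hence by [HW] in that of the compression. *)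
have disc t : I01 t -> forall z, cabs (z - d t) < theta ->
    We ip M (fun x => P (A t x)) z.
  move=> It z hz; rewrite HW //.
  apply: (disc_subset (l := d t)).
    by have [r r0 hr] := Hd t It; apply: hr; rewrite subrr cabs0.
  apply: lt_le_trans hz _; rewrite Htheta; apply: ge_inf; last by exists t.
  by exists 0 => x [s _ <-]; apply: distC_ge0.
(* Writing eps / 16^k as eps (q^k)^2 makes the square root in the correction equal to rho q^k. *)
pose near k (f : R -> H) := contH ip f /\ forall t, I01 t ->
  [/\ hnorm ip (f t) = 1, cabs (ip (A t (f t)) (f t) - d t) <= eps * (q ^+ k) ^+ 2 &
      exists a m, M m /\ f t = a *: v t + m].
(* The implication makes the statement total, so that [choice] yields a map G on all pairs; for
   pairs that are not [near], the path f is a dummy value. *)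
have step kf : exists g, near kf.1 kf.2 -> near kf.1.+1 g /\
    forall t, I01 t -> hnorm ip (g t - kf.2 t) <= 3 * (2 * rho) * q ^+ kf.1.
  case: kf => k f /=; have [[fc hf]|nf] := pselect (near k f); last by exists f.
  have e0 : 0 < eps * (q ^+ k) ^+ 2 by rewrite mulr_gt0 // exprn_gt0.
  have e1 : 0 < eps * (q ^+ k.+1) ^+ 2 by rewrite mulr_gt0 // exprn_gt0.
  have sqrtE : Num.sqrt (eps * (q ^+ k) ^+ 2 / theta) = rho * q ^+ k.
    rewrite mulrAC sqrtrM; last by rewrite divr_ge0 // ltW.
    by rewrite sqrtr_sqr ger0_norm // ltW.
  have f1 t : I01 t -> hnorm ip (f t) = 1 by move=> /hf[].
  have ferr t : I01 t -> cabs (ip (A t (f t)) (f t) - d t) <= eps * (q ^+ k) ^+ 2.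
    by move=> /hf[].
  have [g [gc hg]] := correction_step Hip HA HAc Hdc fc f1 HMs HP disc e0 theta0 e1 ferr.
  exists g => _; split; last first.
    by move=> t /hg[_ _ + _]; rewrite sqrtE; move/le_trans; apply; lra.
  split=> // t It; have [? ? _ [a [m [Mm gE]]]] := hg t It; split=> //.
  (* Substituting f = b v + n into g = a f + m keeps the decomposition relative to the original
     v. *)
  have [_ _ [b [n [Mn fE]]]] := hf t It; exists (a * b), (a *: n + 1 *: m).
  split; first exact: subspaceD.
  by rewrite gE fE scalerDr scalerA scale1r addrA.
have [G hG] := choice step.
pose f := fix f k := if k is k'.+1 then G (k', f k') else v.
have nearf k : near k (f k).
  elim: k => [|k IH]; last by have [] := hG (k, f k) IH.
  split=> // t It; split; first exact: Hv1; first by rewrite expr1n mulr1; apply: Hv.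
  by exists 1, 0; have [M0 _] := HMs; rewrite scale1r addr0.
have fstep k t : I01 t -> hnorm ip (f k.+1 t - f k t) <= 3 * (2 * rho) * q ^+ k.
  by have [_] := hG (k, f k) (nearf k); apply.
have rho2 : 0 <= 2 * rho by lra.
have [u uc hu] := geometric_limit Hip Hcomp rho2 (fun k => proj1 (nearf k)) fstep.
exists u; split=> // t It.
(* One index k serves both bounds: the constants are added, and (q^k)^2 <= q^k. *)
have apx e : 0 < e -> exists k, hnorm ip (u t - f k t) < e /\ eps * (q ^+ k) ^+ 2 <= e.
  move=> e0; have D0 : 0 <= 4 * (2 * rho) + eps by lra.
  have [k hk] := geometric_small D0 e0.
  have hk' : (4 * (2 * rho) + eps) * q ^+ k < e := hk k (leqnn k).
  have q1 : q ^+ k <= 1 by rewrite exprn_ile1 // /q; lra.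
  have r8 : 0 <= 4 * (2 * rho) * q ^+ k by apply: mulr_ge0; [lra | exact: ltW].
  have huk : hnorm ip (u t - f k t) <= 4 * (2 * rho) * q ^+ k := hu k t It.
  have qk := qn k; have epsq := mulr_gt0 eps0 qk.
  exists k; move: (hnorm _ _) (q ^+ k) huk hk' q1 r8 qk epsq => X y *.
  by split; nra.
have [u1 uE] : hnorm ip (u t) = 1 /\ ip (A t (u t)) (u t) = d t.
  apply: quadratic_form_limit => //; first exact: HA.
  move=> e e0; have [k [h1 h2]] := apx e e0; have [_ /(_ t It)[f1 f2 _]] := nearf k.
  by exists (f k t); split=> //; [apply: ltW | apply: le_trans f2 h2].
split=> //.
  (* At index 0 the path is v and the tail bound is 8 rho, within the required 12 rho. *)
  have := hu 0%N t It; rewrite /= mulr1 -/rho; lra.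
apply: clspan_limit => e e0; have [k [h1 _]] := apx e e0.
by exists (f k t); split=> //; have [_ /(_ t It)[]] := nearf k.
Qed.
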